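(* Let $s$ be a positive integer. Given a multipartite graph $G$ with a partition $\mathcal{P}=(V_1,V_2,\ldots,V_r)$, if $\overline{D}_{\mathcal{P}}(G)\le D$ and $\mathcal{P}$ is $4s^2D$-thick, then $G$ has an independent transversal blow-up of size $s$ with respect to $\mathcal{P}$.
   Context: A multipartite graph $G$ with partition $\mathcal{P}=(V_1,\ldots,V_r)$ is a graph whose vertex set is the disjoint union of the blocks $V_1,\ldots,V_r$, each of which is an independent set of $G$. The partition $\mathcal{P}$ is $x$-thick if $|V_i|\ge x$ for every $i\in[r]$. The average degree of a block is $\overline{d}_G(V_i)=\frac{1}{|V_i|}\sum_{v\in V_i}d_G(v)$, and the maximum block average degree is $\overline{D}_{\mathcal{P}}(G)=\max_{i\in[r]}\overline{d}_G(V_i)$. $D$ is an arbitrary number bounding the maximum block average degree. An independent transversal blow-up of size $s$ with respect to $\mathcal{P}$ is an independent set of $G$ consisting of exactly $s$ vertices from each block $V_i$.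
   Formalization: The formal theorem also assumes that every block has at least s vertices; without this the claim fails for small D (an edgeless graph with one-vertex blocks, s = 2, D = 0), and it is automatic when 4sD ≥ 1. *)

(* Defs.v *)
From mathcomp Require Import all_boot all_order all_algebra.
Set Implicit Arguments.
Unset Strict Implicit.
Unset Printing Implicit Defensive.
Import Order.TTheory GRing.Theory Num.Theory.
Local Open Scope ring_scope.

Record sgraph (T : finType) := SGraph {
  edge :> rel T;
  edge_sym : symmetric edge;
  edge_irr : irreflexive edge
}.

Definition degree (T : finType) (G : sgraph T) (v : T) : nat := #|[set w | G v w]|.

Definition independent (T : finType) (G : sgraph T) (S : {set T}) : Prop :=
  forall x y, x \in S -> y \in S -> ~~ G x y.

(* Blocks are an indexed family rather than a {set {set T}}, so that they are
   ordered and emptiness is governed only by [thick]. *)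
Definition multipartite (T : finType) (G : sgraph T) (r : nat)
    (V : 'I_r -> {set T}) : Prop :=
  [/\ \bigcup_i V i = [set: T],
      forall i j, i != j -> [disjoint V i & V j]
    & forall i, independent G (V i)].

Definition thick (R : realFieldType) (T : finType) (r : nat)
    (V : 'I_r -> {set T}) (x : R) : Prop :=
  forall i, x <= #|V i|%:R.

(* Equal to 0 on an empty block. *)
Definition avg_degree (R : realFieldType) (T : finType) (G : sgraph T)
    (A : {set T}) : R :=
  #|A|%:R^-1 * \sum_(v in A) (degree G v)%:R.

(* Averages are nonnegative, so the default value 0 does not affect the maximum
   when r > 0. *)
Definition max_block_avg_degree (R : realFieldType) (T : finType)
    (G : sgraph T) (r : nat) (V : 'I_r -> {set T}) : R :=
  \big[Num.max/0]_(i < r) avg_degree R G (V i).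

Definition independent_transversal_blowup (T : finType) (G : sgraph T)
    (r : nat) (V : 'I_r -> {set T}) (s : nat) (S : {set T}) : Prop :=
  independent G S /\ forall i, #|S :&: V i| = s.

(* Main.v *)
(* Rosenfeld-style counting.  Let P(I) be the number of independent blow-ups of
   size s on the blocks indexed by I, n_i = |V_i| and d_i the degree sum of V_i.
   By induction on |I|, 'C(n_i, s) P(I) <= 2 P(I + i): at least half of the pairs
   (A, S), with A an s-subset of V_i and S counted by P(I), have no edge between
   A and S.  Indeed a vertex w of V_j lies in at most 'C(n_j - 1, s - 1) P(I - j)
   <= 2 s P(I) / n_j of the sets S by the induction hypothesis, while a vertex of
   V_i lies in 'C(n_i - 1, s - 1) = (s / n_i) 'C(n_i, s) of the sets A.  A union
   bound over the d_i edges at V_i then suffices, as 4 s^2 d_i <= n_i n_j. Since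
   P(set0) = 1 and s <= n_i, all the numbers P(I) are positive. *)
Require Import Defs.
From mathcomp Require Import all_boot all_order all_algebra.
From mathcomp Require Import zify.
Set Implicit Arguments.
Unset Strict Implicit.
Unset Printing Implicit Defensive.
Import Order.TTheory GRing.Theory Num.Theory.

Definition draws (T : finType) (A : {set T}) (s : nat) : {set {set T}} :=
  [set B : {set T} | B \subset A & #|B| == s].

Definition blowups (T : finType) (G : sgraph T) (r : nat) (V : 'I_r -> {set T})
    (s : nat) (I : {set 'I_r}) : {set {set T}} :=
  [set S : {set T} | [&& S \subset \bigcup_(i in I) V i,
     [forall x in S, forall y in S, ~~ G x y]
   & [forall i in I, #|S :&: V i| == s]]].

Lemma blowupsP (T : finType) (G : sgraph T) (r : nat) (V : 'I_r -> {set T})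
    (s : nat) (I : {set 'I_r}) (S : {set T}) :
  reflect [/\ S \subset \bigcup_(i in I) V i, independent G S
            & forall i, i \in I -> #|S :&: V i| = s]
          (S \in blowups G V s I).
Proof.
rewrite inE; apply: (iffP and3P) => -[subS indS cardS]; split=> //.
- by move=> x y xS yS; have /forall_inP/(_ y yS) := forall_inP indS x xS.
- by move=> i iI; apply/eqP; exact: (forall_inP cardS).
- by apply/forall_inP=> x xS; apply/forall_inP=> y yS; exact: indS.
- by apply/forall_inP=> i iI; apply/eqP; exact: cardS.
Qed.

Lemma blowups0 (T : finType) (G : sgraph T) (r : nat) (V : 'I_r -> {set T})
    (s : nat) : set0 \in blowups G V s set0.
Proof.
by apply/blowupsP; split=> [|x y|i]; rewrite ?sub0set // inE.
Qed.

Lemma leq_card_inj_in (aT rT : finType) (f : aT -> rT) (A : {set aT})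
    (B : {set rT}) :
  {in A &, injective f} -> {in A, forall x, f x \in B} -> #|A| <= #|B|.
Proof.
move=> injf fAB; rewrite -(card_in_imset injf).
by apply/subset_leq_card/subsetP=> _ /imsetP[x xA ->]; exact: fAB.
Qed.

(** Deleting [v] is injective on the sets that contain it and yields [s.-1]-subsets of [A :\ v]. *)
Lemma card_draws_mem (T : finType) (A : {set T}) (s : nat) (v : T) :
  0 < s -> v \in A ->
  #|[set B in draws A s | v \in B]| <= 'C(#|A|.-1, s.-1).
Proof.
move=> s_gt0 vA.
have -> : #|A|.-1 = #|A :\ v| by rewrite (cardsD1 v A) vA.
rewrite -cards_draws; apply: (leq_card_inj_in (f := fun B => B :\ v)) => B.
  move=> C; rewrite !inE => /andP[_ vB] /andP[_ vC] eqBC.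
  by rewrite -(setD1K vB) -(setD1K vC) eqBC.
rewrite !inE => /andP[/andP[sBA /eqP cB] vB].
by rewrite setSD //= -cB [in X in _ == X](cardsD1 v B) vB.
Qed.

Lemma blowups_remove (T : finType) (G : sgraph T) (r : nat)
    (V : 'I_r -> {set T}) (s : nat) (I : {set 'I_r}) (j : 'I_r) (S : {set T}) :
  (forall i k, i != k -> [disjoint V i & V k]) ->
  S \in blowups G V s I -> S :\: V j \in blowups G V s (I :\ j).
Proof.
move=> dV /blowupsP[subS indS cardS]; apply/blowupsP; split.
- apply/subsetP=> x /setDP[xS xj].
  have /bigcupP[k kI xk] := subsetP subS x xS.
  apply/bigcupP; exists k => //; rewrite !inE kI andbT.
  by apply: contraNneq xj => <-.
- by move=> x y /setDP[xS _] /setDP[yS _]; exact: indS.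
- move=> k; rewrite !inE => /andP[kj kI]; rewrite -(cardS k kI).
  apply: eq_card => x; rewrite !inE; case xk: (x \in V k); last by rewrite !andbF.
  by rewrite (disjointFr (dV _ _ kj) xk).
Qed.

Lemma blowups_add (T : finType) (G : sgraph T) (r : nat)
    (V : 'I_r -> {set T}) (s : nat) (I : {set 'I_r}) (i : 'I_r)
    (A S : {set T}) :
  (forall j k, j != k -> [disjoint V j & V k]) ->
  independent G (V i) -> i \notin I ->
  A \in draws (V i) s -> S \in blowups G V s I ->
  (forall v w, v \in A -> w \in S -> ~~ G v w) ->
  A :|: S \in blowups G V s (i |: I).
Proof.
move=> dV indV iI; rewrite inE => /andP[sAV /eqP cA] /blowupsP[subS indS cardS].
move=> noedge; apply/blowupsP; split.
- rewrite bigcup_setU big_set1; exact: setUSS.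
- move=> x y /setUP[xA|xS] /setUP[yA|yS].
  + by apply: indV; exact: (subsetP sAV).
  + exact: noedge.
  + by rewrite edge_sym; exact: noedge.
  + exact: indS.
- move=> k /setU1P[->|kI].
    rewrite -cA; apply: eq_card => x; rewrite !inE.
    case xA: (x \in A); first by rewrite (subsetP sAV).
    apply/negbTE/negP=> /= /andP[xS xi].
    have /bigcupP[l lI xl] := subsetP subS x xS.
    have li : l != i by apply: contraNneq iI => <-.
    by rewrite (disjointFr (dV _ _ li) xl) in xi.
  rewrite -(cardS k kI); apply: eq_card => x; rewrite !inE.
  case xA: (x \in A) => //=.
  have ik : i != k by apply: contraNneq iI => ->.
  by rewrite (disjointFr (dV _ _ ik) (subsetP sAV x xA)) andbF.
Qed.

(** A set [S] is determined by its trace on [V j], an [s]-subset containing [w], and by the rest, a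
    blow-up on [I :\ j]. *)
Lemma card_blowups_mem (T : finType) (G : sgraph T) (r : nat)
    (V : 'I_r -> {set T}) (s : nat) (I : {set 'I_r}) (j : 'I_r) (w : T) :
  (forall i k, i != k -> [disjoint V i & V k]) ->
  0 < s -> j \in I -> w \in V j ->
  #|[set S in blowups G V s I | w \in S]|
    <= 'C(#|V j|.-1, s.-1) * #|blowups G V s (I :\ j)|.
Proof.
move=> dV s_gt0 jI wj.
apply: (@leq_trans #|setX [set B in draws (V j) s | w \in B]
                          (blowups G V s (I :\ j))|); last first.
  by rewrite cardsX leq_mul2r card_draws_mem ?orbT.
apply: (leq_card_inj_in (f := fun S => (S :&: V j, S :\: V j))) => S.
  by move=> S' _ _ [eqI eqD]; rewrite -(setID S (V j)) -(setID S' (V j)) eqI eqD.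
rewrite inE => /andP[SI wS]; rewrite in_setX /= blowups_remove // andbT.
have /blowupsP[_ _ cardS] := SI.
by rewrite !inE subsetIr cardS // eqxx wS wj.
Qed.

Lemma card_bigcup_leq (I T : finType) (P : pred I) (F : I -> {set T}) :
  #|\bigcup_(i | P i) F i| <= \sum_(i | P i) #|F i|.
Proof.
elim/big_rec2: _ => [|i m A _ leAm]; first by rewrite cards0.
by rewrite (leq_trans (leq_card_setU _ _)) // leq_add2l.
Qed.

Lemma card_blowups_add (T : finType) (G : sgraph T) (r : nat)
    (V : 'I_r -> {set T}) (s : nat) (I : {set 'I_r}) (i : 'I_r) :
  multipartite G V -> 0 < s -> (forall j, 0 < #|V j|) ->
  (forall j k, 4 * s ^ 2 * (\sum_(v in V j) degree G v) <= #|V j| * #|V k|) ->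
  i \notin I ->
  'C(#|V i|, s) * #|blowups G V s I| <= 2 * #|blowups G V s (i |: I)|.
Proof.
move=> [_ dV indV] s_gt0 V_gt0 dens.
(* The added block [i] stays general: the induction hypothesis is used for [I :\ j] with [j] put
   back. *)
elim: {I}_.+1 {-2}I (ltnSn #|I|) i => // n IHn I leIn i iI.
set P := #|blowups G V s I|; set n_i := #|V i|.
set d := \sum_(v in V i) degree G v.
pose pairs := setX (draws (V i) s) (blowups G V s I).
pose bad := [set p : {set T} * {set T} | [exists v in p.1, exists w in p.2, G v w]].
(* Since [S] misses [V i], cutting [A :|: S] along [V i] recovers the pair, so the union map is
   injective on good pairs. *)
have good_le : #|pairs :\: bad| <= #|blowups G V s (i |: I)|.
  have disjS S : S \in blowups G V s I -> S :&: V i = set0.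
    case/blowupsP=> subS _ _; apply/setP=> x; rewrite !inE.
    apply/negP=> /andP[xS xi]; have /bigcupP[k kI xk] := subsetP subS x xS.
    have ki : k != i by apply: contraNneq iI => <-.
    by rewrite (disjointFr (dV _ _ ki) xk) in xi.
  have cutS (A S : {set T}) : A \subset V i -> S \in blowups G V s I ->
      ((A :|: S) :&: V i, (A :|: S) :\: V i) = (A, S).
    move=> sA SI; rewrite setIUl (disjS S) // setU0 (setIidPl sA); congr pair.
    move: (sA); rewrite setDUl -setD_eq0 => /eqP ->; rewrite set0U.
    by apply/setDidPl; rewrite -setI_eq0 disjS.
  apply: (leq_card_inj_in (f := fun p : {set T} * {set T} => p.1 :|: p.2)) => -[A S].
    move=> [A' S'] /setDP[/setXP[/= + SI] _] /setDP[/setXP[/= + SI'] _] /=.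
    rewrite !inE => /andP[sA _] /andP[sA' _] eqU.
    by rewrite -(cutS A S) // eqU cutS.
  move=> /setDP[/setXP[/= AV SI]]; rewrite inE /= => nobad.
  apply: blowups_add => // v w vA wS; apply: contra nobad => vw.
  by apply/exists_inP; exists v => //; apply/exists_inP; exists w.
(* Either no [S] contains [w], or one of them places [w] in a block [V j] with [j] in [I], where the
   induction hypothesis applies. *)
have occ_le w : 2 * s * d * #|[set S in blowups G V s I | w \in S]| <= n_i * P.
  case: (set_0Vmem [set S in blowups G V s I | w \in S]) => [->|[S]].
    by rewrite cards0 muln0.
  rewrite inE => /andP[/blowupsP[subS _ _] /(subsetP subS)/bigcupP[j jI wj]].
  have cardI : #|I :\ j| < n by move: leIn; rewrite (cardsD1 j I) jI.
  have := IHn _ cardI j; rewrite setD11 setD1K // => /(_ isT) stepj.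
  have mem_le := card_blowups_mem G dV s_gt0 jI wj.
  (* The absorption identity n C(n-1, s-1) = s C(n, s) brings the bound on occurrences into the form
     of [stepj]. *)
  have := mul_bin_diag #|V j| s.-1; rewrite prednK // => diagj.
  have c_le : #|V j| * #|[set S in blowups G V s I | w \in S]| <= 2 * s * P.
    apply: leq_trans (leq_mul (leqnn _) mem_le) _.
    by rewrite mulnA diagj -mulnA -[2 * s]mulnC -mulnA leq_mul2l stepj orbT.
  (* The product of [dens i j] and [c_le] is the goal times this positive factor. *)
  rewrite -(leq_pmul2l (_ : 0 < 2 * s * #|V j|)) ?muln_gt0 ?s_gt0 ?V_gt0 //.
  have := leq_mul (dens i j) c_le; rewrite -/d -/n_i expnS expn1.
  by congr (_ <= _); lia.
have bad_le : #|pairs :&: bad| <=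
    \sum_(v in V i) \sum_(w in [set w | G v w])
      'C(n_i.-1, s.-1) * #|[set S in blowups G V s I | w \in S]|.
  pose over v w := setX [set A in draws (V i) s | v \in A]
                        [set S in blowups G V s I | w \in S].
  apply: (@leq_trans #|\bigcup_(v in V i) \bigcup_(w in [set w | G v w]) over v w|).
    apply/subset_leq_card/subsetP=> -[A S] /setIP[/setXP[/= AV SI]].
    rewrite inE /= => /exists_inP[v vA /exists_inP[w wS vw]].
    have vi : v \in V i by move: AV vA; rewrite inE => /andP[/subsetP + _]; apply.
    apply/bigcupP; exists v => //; apply/bigcupP; exists w; first by rewrite inE.
    by apply/setXP; split; apply/setIdP.
  apply: leq_trans (card_bigcup_leq _ _) (leq_sum _ _) => v vi.
  apply: leq_trans (card_bigcup_leq _ _) (leq_sum _ _) => w _.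
  by rewrite cardsX leq_mul2r card_draws_mem ?orbT.
have half_bad : 2 * #|pairs :&: bad| <= 'C(n_i, s) * P.
  (* For [d = 0] the bound [occ_le] is void, but then no edge meets [V i] and no pair is bad. *)
  have [d0|d_gt0] := posnP d.
    suff -> : #|pairs :&: bad| = 0 by [].
    apply/eqP; rewrite -leqn0 (leq_trans bad_le) // big1 // => v vi.
    apply: big1 => w vw.
    have : degree G v <= d by rewrite /d (bigD1 v) //= leq_addr.
    rewrite d0 leqn0 cards_eq0 => /eqP N0.
    by rewrite N0 inE in vw.
  (* The double sum in [bad_le] has [d] terms, each bounded by [occ_le]; absorption at [n_i] then
     lets [s * d] cancel. *)
  have sum_le : 2 * s * d * #|pairs :&: bad| <= d * ('C(n_i.-1, s.-1) * (n_i * P)).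
    apply: leq_trans (leq_mul (leqnn _) bad_le) _.
    rewrite big_distrr {2}/d big_distrl /=.
    apply: leq_sum => v vi; rewrite big_distrr /= /degree -sum_nat_const.
    by apply: leq_sum => w _; rewrite mulnCA leq_mul2l occ_le orbT.
  have := mul_bin_diag n_i s.-1; rewrite prednK // => diagi.
  rewrite -(leq_pmul2l (_ : 0 < s * d)) ?muln_gt0 ?s_gt0 //.
  apply: leq_trans (_ : d * (n_i * 'C(n_i.-1, s.-1) * P) <= _); last first.
    by rewrite diagi; nia.
  by move: sum_le; congr (_ <= _); lia.
have total : #|pairs :&: bad| + #|pairs :\: bad| = 'C(n_i, s) * P.
  by rewrite cardsID cardsX cards_draws.
lia.
Qed.

Lemma blowups_nonempty (T : finType) (G : sgraph T) (r : nat)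
    (V : 'I_r -> {set T}) (s : nat) (I : {set 'I_r}) :
  multipartite G V -> 0 < s -> (forall j, s <= #|V j|) ->
  (forall j k, 4 * s ^ 2 * (\sum_(v in V j) degree G v) <= #|V j| * #|V k|) ->
  0 < #|blowups G V s I|.
Proof.
move=> mG s_gt0 V_ge dens.
have V_gt0 j : 0 < #|V j| by exact: leq_trans (V_ge j).
elim: {I}_.+1 {-2}I (ltnSn #|I|) => // n IHn I leIn.
have [->|[i iI]] := set_0Vmem I.
  by apply/card_gt0P; exists set0; exact: blowups0.
have cardI : #|I :\ i| < n by move: leIn; rewrite (cardsD1 i I) iI.
have := card_blowups_add (I := I :\ i) mG s_gt0 V_gt0 dens.
move=> /(_ i); rewrite setD11 setD1K // => /(_ isT).
(* As [s <= #|V i|], the binomial coefficient is positive, so positivity passes from [I :\ i] to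
   [I]. *)
have := IHn _ cardI; have := V_ge i; rewrite -bin_gt0; nia.
Qed.

Local Open Scope ring_scope.

(* If 4sD >= 1 then 4s^2D >= s and [thick V s%:R] follows from the thickness
   hypothesis. For smaller D the blocks may have fewer than s vertices (edgeless
   graph, D = 0), and the conclusion cannot hold unless every block has at least
   s vertices. *)
Theorem theorem4p3 (R : realFieldType) (s : nat) (T : finType) (G : sgraph T)
    (r : nat) (V : 'I_r -> {set T}) (D : R) :
  (0 < s)%N ->
  multipartite G V ->
  max_block_avg_degree R G V <= D ->
  thick V (4 * s%:R ^+ 2 * D) ->
  thick V (s%:R : R) ->
  exists S : {set T}, independent_transversal_blowup G V s S.
Proof.
move=> s_gt0 mG degD thickD thicks.
have V_ge j : (s <= #|V j|)%N by rewrite -(ler_nat R).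
have V_gt0 j : (0 < #|V j|)%N by exact: leq_trans (V_ge j).
(* The average bounds the degree sum of [V j] by [D] times its size, and the thickness of [V k]
   absorbs the factor 4 s^2 D. *)
have dens j k : (4 * s ^ 2 * (\sum_(v in V j) degree G v) <= #|V j| * #|V k|)%N.
  have avgD : avg_degree R G (V j) <= D.
    apply: le_trans degD; rewrite /max_block_avg_degree.
    exact: (le_bigmax 0 (fun i => avg_degree R G (V i))).
  rewrite /avg_degree mulrC ler_pdivrMr ?ltr0n // in avgD.
  rewrite -(ler_nat R) !natrM natr_sum -expr2.
  apply: (@le_trans _ _ (4 * s%:R ^+ 2 * (D * #|V j|%:R))).
    by rewrite ler_wpM2l // mulr_ge0 ?exprn_ge0.
  by rewrite mulrA mulrC ler_wpM2l.
have /card_gt0P[S /blowupsP[_ indS cardS]] :=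
  blowups_nonempty [set: 'I_r] mG s_gt0 V_ge dens.
by exists S; split=> // i; exact: cardS.
Qed.
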